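(* Let $\mathrm{M}$ be a matroid of positive rank $d$ on a finite set $E$, and let $w=(w_e)_{e\in E}$ be positive real weights. Let $\mathrm{B}$ be a random basis of $\mathrm{M}$ with $\mathbb{P}(\mathrm{B}=b)$ proportional to $\prod_{e\in b} w_e$ for each basis $b$. Then for any distinct elements $i,j\in E$, \[ \mathbb{P}(i \in \mathrm{B}, j \in \mathrm{B})\ \mathbb{P}(i \notin \mathrm{B}, j \notin \mathrm{B}) \le 2\Big(1-\frac{1}{d}\Big)\ \mathbb{P}(i \in \mathrm{B}, j \notin \mathrm{B})\ \mathbb{P}(i \notin \mathrm{B}, j \in \mathrm{B}). \]
   Context: A matroid on a finite set $E$ is a nonempty collection of subsets of $E$ (bases) satisfying the basis exchange property; its rank is the common cardinality of its bases. *)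

(* Defs.v *)
From HB Require Import structures.
From mathcomp Require Import all_boot all_order all_algebra.
From mathcomp Require Import reals.

Set Implicit Arguments.
Unset Strict Implicit.
Unset Printing Implicit Defensive.

Import Order.TTheory GRing.Theory Num.Theory.
Local Open Scope ring_scope.

Record matroid (E : finType) := Matroid {
  bases : {set {set E}};
  bases_neq0 : bases != set0;
  basis_exchange : forall A B : {set E}, A \in bases -> B \in bases ->
    forall a, a \in A :\: B ->
    exists2 b, b \in B :\: A & b |: (A :\ a) \in bases }.

Lemma bases_equicardinal (E : finType) (M : matroid E) (A B : {set E}) :
  A \in bases M -> B \in bases M -> #|A| = #|B|.
Proof.
move=> + MB; elim: {A}_.+1 {-2}A (ltnSn #|A :\: B|) => // n IHn A leAB MA.
have [AB0|[a aAB]] := set_0Vmem (A :\: B).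
  have [BA0|[b bBA]] := set_0Vmem (B :\: A).
    by congr #|pred_of_set _|; apply/eqP; rewrite eqEsubset -!setD_eq0 AB0 BA0 eqxx.
  by have [c] := basis_exchange MB MA bBA; rewrite AB0 inE.
have [b bBA MA'] := basis_exchange MA MB aAB.
move: (aAB) (bBA); rewrite !inE => /andP[aB aA] /andP[bA bB].
rewrite -(IHn _ _ MA').
  by rewrite cardsU1 !inE (negPf bA) andbF (cardsD1 a A) aA.
apply: (@leq_trans #|A :\: B|) => //; apply: proper_card.
apply/properP; split; last first.
  by exists a; rewrite // !inE eqxx aB /= orbF; apply: contraNneq bA => <-.
apply/subsetP => x; rewrite !inE => /andP[xB /orP[/eqP xb|/andP[_ xA]]].
  by rewrite xb bB in xB.
by rewrite xB.
Qed.

(* The common cardinality of the bases, see [card_basis]. *)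
Definition rank (E : finType) (M : matroid E) : nat :=
  (\max_(b in bases M) #|b|)%N.

Lemma card_basis (E : finType) (M : matroid E) (b : {set E}) :
  b \in bases M -> #|b| = rank M.
Proof.
move=> Mb; apply/eqP; rewrite eqn_leq leq_bigmax_cond //.
by apply/bigmax_leqP => c Mc; rewrite (bases_equicardinal Mc Mb).
Qed.

Definition basis_weight (R : realType) (E : finType) (w : E -> R)
  (b : {set E}) : R := \prod_(e in b) w e.

Definition total_weight (R : realType) (E : finType) (M : matroid E)
  (w : E -> R) : R := \sum_(b in bases M) basis_weight w b.

Definition basis_law (R : realType) (E : finType) (M : matroid E)
  (w : E -> R) (b : {set E}) : R :=
  if b \in bases M then basis_weight w b / total_weight M w else 0.

(* The probability that the random basis satisfies [A]. *)
Definition Pr (R : realType) (E : finType) (M : matroid E) (w : E -> R)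
  (A : pred {set E}) : R := \sum_(b | A b) basis_law M w b.

Lemma total_weight_gt0 (R : realType) (E : finType) (M : matroid E)
  (w : E -> R) : (forall e, 0 < w e) -> 0 < total_weight M w.
Proof.
move=> w_gt0; have [b Mb] := set0Pn _ (bases_neq0 M).
rewrite /total_weight (bigD1 b) //=; apply: ltr_wpDr; last exact: prodr_gt0.
by apply: sumr_ge0 => c _; apply/ltW/prodr_gt0.
Qed.

Lemma basis_law_ge0 (R : realType) (E : finType) (M : matroid E)
  (w : E -> R) (b : {set E}) : (forall e, 0 < w e) -> 0 <= basis_law M w b.
Proof.
move=> w_gt0; rewrite /basis_law; case: ifP => // _.
by apply: divr_ge0; apply/ltW; [apply: prodr_gt0|exact: total_weight_gt0].
Qed.

Lemma PrT (R : realType) (E : finType) (M : matroid E) (w : E -> R) :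
  (forall e, 0 < w e) -> Pr M w predT = 1.
Proof.
move=> w_gt0.
by rewrite /Pr -big_mkcond /= -mulr_suml divff // gt_eqF // total_weight_gt0.
Qed.

(* Main.v *)
(** For an independent set [I] let [mass I] be the total weight of the bases
    containing [I] and [r] the corank of [I].  The quadratic form
    [sum_(i != j) mass (I + i + j) y_i y_j] of the contraction by [I] is shown to
    have Lorentzian signature, in the quantitative form
    [r * mass I * form y <= (r - 1) * (sum_i mass (I + i) y_i)^2].  For [r = 2] the
    form is, up to rescaling the coordinates, a square minus the sum of squares
    over the parallel classes.  For [r > 2] it is a sum of the forms of the
    contractions by [I + i]; these give [H <= H D^-1 H] for the matrix [H] of the
    form, with [D] the diagonal of its row sums, and since the contraction has
    connected adjacency graph this forces [H <= 0] on the complement of the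
    constant vectors.
    At [I = set0], a vector [y] supported on [i, j] yields
    [d P(i, j in B) <= 2 (d - 1) P(i in B) P(j in B)]; scaling [w i] and [w j] by
    [t] and letting [t] tend to [0] gives the theorem. *)

Require Import Defs.
From HB Require Import structures.
From mathcomp Require Import all_boot all_order all_algebra.
From mathcomp Require Import reals ring lra.

Set Implicit Arguments.
Unset Strict Implicit.
Unset Printing Implicit Defensive.

Import Order.TTheory GRing.Theory Num.Theory.
Local Open Scope ring_scope.

(** * Forms of weighted graphs and a criterion for a single positive direction *)

Section QuadraticForms.
Variables (R : realFieldType) (E : finType).
Implicit Types (H P : E -> E -> R) (x y z v : E -> R).

Definition bform H x y : R := \sum_i \sum_j H i j * x i * y j.

Lemma bformE H x y : bform H x y = \sum_i x i * \sum_j H i j * y j.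
Proof.
by apply: eq_bigr => i _; rewrite mulr_sumr; apply: eq_bigr => j _; ring.
Qed.

Lemma bformC H x y : (forall i j, H i j = H j i) -> bform H x y = bform H y x.
Proof.
move=> Hsym; rewrite /bform exchange_big /=; apply: eq_bigr => j _.
by apply: eq_bigr => i _; rewrite Hsym; ring.
Qed.

Lemma bform_lincomb H a b x y : (forall i j, H i j = H j i) ->
  bform H (fun i => a * x i + b * y i) (fun i => a * x i + b * y i) =
  a ^+ 2 * bform H x x + 2 * a * b * bform H x y + b ^+ 2 * bform H y y.
Proof.
move=> Hsym.
have -> : 2 * a * b * bform H x y = a * b * bform H x y + a * b * bform H y x.
  by rewrite (bformC y) //; ring.
rewrite /bform !mulr_sumr -!big_split /=; apply: eq_bigr => i _.
rewrite !mulr_sumr -!big_split /=; apply: eq_bigr => j _; ring.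
Qed.

(** A row-free square matrix is invertible; [enum_rank] carries functions on [E] to row vectors. *)
Lemma injective_solvable P :
  (forall v, (forall j, \sum_i v i * P i j = 0) -> forall i, v i = 0) ->
  forall x, exists z, forall j, \sum_i z i * P i j = x j.
Proof.
move=> injP x.
pose A : 'M[R]_#|E| := \matrix_(a, b) P (enum_val a) (enum_val b).
have sumE (F : E -> R) : \sum_i F i = \sum_(a < #|E|) F (enum_val a).
  by rewrite (reindex _ (onW_bij _ (@enum_val_bij E))).
have freeA : row_free A.
  rewrite -kermx_eq0; apply/rowV0P => u /sub_kermxP uA0.
  have v0 : forall i, u 0 (enum_rank i) = 0.
    apply: injP => j; rewrite sumE.
    have := congr1 (fun X : 'rV_ _ => X 0 (enum_rank j)) uA0; rewrite !mxE => uA.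
    rewrite -[RHS]uA; apply: eq_bigr => a _.
    by rewrite !mxE enum_valK enum_rankK.
  by apply/rowP => a; rewrite mxE -(v0 (enum_val a)) enum_valK.
pose u : 'rV[R]_#|E| := (\row_a x (enum_val a)) *m invmx A.
exists (fun i => u 0 (enum_rank i)) => j; rewrite sumE.
have uA : u *m A = \row_a x (enum_val a) by rewrite mulmxKV // -row_free_unit.
have := congr1 (fun X : 'rV_ _ => X 0 (enum_rank j)) uA.
rewrite !mxE enum_rankK => <-; apply: eq_bigr => a _.
by rewrite !mxE enum_valK enum_rankK.
Qed.

Variables (H : E -> E -> R) (p : E -> R).
Hypotheses (H_sym : forall i j, H i j = H j i) (H_ge0 : forall i j, 0 <= H i j).
Hypothesis H_sum : forall i, \sum_j H i j = p i.

(** This is the Laplacian form of the graph with edge weights [H] and degrees [p]; [2^-1]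
    compensates for counting each pair in both orders. *)
Lemma dirichlet_form x :
  \sum_i p i * x i ^+ 2 - bform H x x =
  \sum_i \sum_j 2^-1 * H i j * (x i - x j) ^+ 2.
Proof.
have E1 : \sum_i p i * x i ^+ 2 = \sum_i \sum_j H i j * x i ^+ 2.
  by apply: eq_bigr => i _; rewrite -H_sum mulr_suml.
have E2 : \sum_i p i * x i ^+ 2 = \sum_i \sum_j H i j * x j ^+ 2.
  rewrite E1 exchange_big /=; apply: eq_bigr => j _.
  by apply: eq_bigr => i _; rewrite H_sym.
have -> : \sum_i p i * x i ^+ 2 =
    \sum_i \sum_j (2^-1 * H i j * x i ^+ 2 + 2^-1 * H i j * x j ^+ 2).
  transitivity (2^-1 * (\sum_i p i * x i ^+ 2) + 2^-1 * \sum_i p i * x i ^+ 2).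
    by field.
  rewrite {1}E1 E2 !mulr_sumr -big_split /=; apply: eq_bigr => i _.
  rewrite !mulr_sumr -big_split /=; apply: eq_bigr => j _; ring.
rewrite /bform -sumrB; apply: eq_bigr => i _.
by rewrite -sumrB; apply: eq_bigr => j _; field.
Qed.

Lemma bform_le_diag x : bform H x x <= \sum_i p i * x i ^+ 2.
Proof.
rewrite -subr_ge0 dirichlet_form; apply: sumr_ge0 => i _; apply: sumr_ge0 => j _.
by rewrite mulr_ge0 ?sqr_ge0 ?mulr_ge0 ?invr_ge0 ?ler0n.
Qed.

Hypothesis H_connected : forall x,
  (forall i j, 0 < H i j -> x i = x j) ->
  forall i j, 0 < p i -> 0 < p j -> x i = x j.
(** Spectrally, an eigenvalue [l] of [D^-1 H] satisfies [l <= l ^+ 2] by this bound and [l <= 1] by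
    [bform_le_diag], so it is [1] or at most [0]; [H_connected] leaves [1] at most simple. Where
    [p i = 0] the quotient is [0], and so is row [i] of [H]. *)
Hypothesis H_garding : forall x,
  bform H x x <= \sum_i (\sum_j H i j * x j) ^+ 2 / p i.

Let p_ge0 i : 0 <= p i.
Proof. by rewrite -H_sum; apply: sumr_ge0. Qed.

Let H_eq0 i j : p i = 0 -> H i j = 0.
Proof.
rewrite -H_sum => /eqP; rewrite psumr_eq0 // => /allP/(_ j).
by rewrite mem_index_enum => /(_ isT)/eqP.
Qed.

(* A copy of [p] made positive, so that the diagonal matrix it defines is
   invertible. *)
Let D i := if p i == 0 then 1 else p i.

Let D_gt0 i : 0 < D i.
Proof. by rewrite /D; case: eqP => // /eqP pi; rewrite lt_def pi p_ge0. Qed.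

Let p_le_D i : p i <= D i.
Proof. by rewrite /D; case: eqP => // ->. Qed.

(** [D - H] is positive semidefinite, but kills the functions constant on the vertices of positive
    degree and zero elsewhere; the rank-one term restores invertibility. *)
Let P i j := D i *+ (i == j) - H i j + p i * p j.

Let sumP v j : \sum_i v i * P i j =
  D j * v j - \sum_i H j i * v i + p j * \sum_i p i * v i.
Proof.
have -> : D j * v j = \sum_i v i * (D i *+ (i == j)).
  rewrite (bigD1 j) //= eqxx mulr1n big1 ?addr0 ?(mulrC (D j)) // => i /negbTE ->.
  by rewrite mulr0.
rewrite mulr_sumr -sumrB -big_split; apply: eq_bigr => i _.
by rewrite /P (H_sym j i) /=; ring.
Qed.

(** The form of [P] at [v] splits into three nonnegative terms. The first vanishes only if [v] is
    zero at vertices of degree zero, the second only if [v] is constant along edges, hence on all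
    other vertices, and the third then makes that constant zero. *)
Let P_inj v : (forall j, \sum_i v i * P i j = 0) -> forall i, v i = 0.
Proof.
move=> vP0.
have q0 : \sum_j v j * \sum_i v i * P i j = 0.
  by apply: big1 => j _; rewrite vP0 mulr0.
have qE : \sum_j v j * \sum_i v i * P i j =
    \sum_j (D j - p j) * v j ^+ 2
    + (\sum_j p j * v j ^+ 2 - bform H v v) + (\sum_j p j * v j) ^+ 2.
  have -> : (\sum_j p j * v j) ^+ 2 = \sum_j p j * v j * \sum_i p i * v i.
    by rewrite -mulr_suml.
  rewrite bformE -sumrB -!big_split; apply: eq_bigr => j _ /=.
  by rewrite sumP; ring.
have t1 : 0 <= \sum_j (D j - p j) * v j ^+ 2.
  by apply: sumr_ge0 => j _; rewrite mulr_ge0 ?subr_ge0 ?sqr_ge0.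
have t2 : 0 <= \sum_j p j * v j ^+ 2 - bform H v v.
  by rewrite subr_ge0 bform_le_diag.
have t3 := sqr_ge0 (\sum_j p j * v j).
rewrite qE in q0.
have pv0 : \sum_j p j * v j = 0 by apply/eqP; rewrite -sqrf_eq0; apply/eqP; lra.
have z1 : \sum_j (D j - p j) * v j ^+ 2 = 0 by lra.
have z2 : \sum_j p j * v j ^+ 2 - bform H v v = 0 by lra.
have edge i j : 0 < H i j -> v i = v j.
  move=> Hij; move/eqP: z2; rewrite dirichlet_form psumr_eq0; last first.
    move=> k _; apply: sumr_ge0 => l _.
    by rewrite mulr_ge0 ?sqr_ge0 ?mulr_ge0 ?invr_ge0 ?ler0n.
  move=> /allP/(_ i); rewrite mem_index_enum => /(_ isT).
  rewrite psumr_eq0; last by move=> l _; rewrite mulr_ge0 ?sqr_ge0 ?mulr_ge0 ?invr_ge0 ?ler0n.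
  move=> /allP/(_ j); rewrite mem_index_enum => /(_ isT).
  by rewrite !mulf_eq0 (gt_eqF Hij) invr_eq0 pnatr_eq0 /= orbb subr_eq0 => /eqP.
move=> i; have [pi0|pi0] := eqVneq (p i) 0.
  move/eqP: z1; rewrite psumr_eq0; last first.
    by move=> j _; rewrite mulr_ge0 ?subr_ge0 ?sqr_ge0.
  move=> /allP/(_ i); rewrite mem_index_enum => /(_ isT).
  by rewrite /D pi0 eqxx subr0 mul1r sqrf_eq0 => /eqP.
have pi_gt0 : 0 < p i by rewrite lt_def pi0 p_ge0.
have vp : v i * \sum_j p j = 0.
  rewrite -[RHS]pv0 mulr_sumr; apply: eq_bigr => j _; rewrite mulrC.
  have [->|pj0] := eqVneq (p j) 0; first by rewrite !mul0r.
  by rewrite (H_connected edge (i := i) (j := j)) // lt_def pj0 p_ge0.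
have S_gt0 : 0 < \sum_j p j.
  by rewrite (bigD1 i) //= ltr_pwDl // sumr_ge0.
by move/eqP: vp; rewrite mulf_eq0 (gt_eqF S_gt0) orbF => /eqP.
Qed.

(* Taking [z] with [(D - H) z = D x], [H_garding] at [z] gives
   [<x, D (z - x)> <= 0], while [D - H >= 0] at [z - x] gives
   [bform H x x <= <x, D (z - x)>]. *)
Lemma bform_le0 x : \sum_i p i * x i = 0 -> bform H x x <= 0.
Proof.
move=> px0.
have [z zP] := injective_solvable P_inj (fun j => D j * x j).
have hz j : \sum_i H j i * z i = D j * (z j - x j) + p j * \sum_i p i * z i.
  by have := zP j; rewrite sumP => h; lra.
(* The rank-one term of [P] drops out: summing the system over the vertices of positive degree, with
   [p] orthogonal to [x], gives [(\sum_j p j) * s = 0]. *)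
have ps0 j : p j * \sum_i p i * z i = 0.
  set s := \sum_i p i * z i.
  have e1 : \sum_j \sum_i H j i * z i = s.
    rewrite exchange_big; apply: eq_bigr => i _ /=; rewrite -H_sum mulr_suml.
    by apply: eq_bigr => k _; rewrite H_sym.
  have e2 : \sum_j \sum_i H j i * z i = s - 0 + (\sum_j p j) * s.
    rewrite -[X in s - X]px0 -sumrB mulr_suml -big_split /=; apply: eq_bigr => k _.
    have [pk|pk] := eqVneq (p k) 0.
      by rewrite pk !mul0r subrr addr0; apply: big1 => i _; rewrite H_eq0 ?mul0r.
    by rewrite hz /D (negbTE pk) -/s; ring.
  have : (\sum_j p j) * s = 0 by lra.
  move=> /eqP; rewrite mulf_eq0 => /orP[|/eqP ->]; last by rewrite mulr0.
  rewrite psumr_eq0 // => /allP/(_ j); rewrite mem_index_enum => /(_ isT)/eqP ->.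
  by rewrite mul0r.
have {}hz j : \sum_i H j i * z i = D j * (z j - x j) by rewrite hz ps0 addr0.
have qz : bform H z z = \sum_j D j * z j * (z j - x j).
  by rewrite bformE; apply: eq_bigr => j _; rewrite hz; ring.
have qxz : bform H x z = \sum_j D j * x j * (z j - x j).
  by rewrite bformE; apply: eq_bigr => j _; rewrite hz; ring.
have g : bform H z z <= \sum_j D j * (z j - x j) ^+ 2.
  apply: le_trans (H_garding z) _; apply: ler_sum => j _.
  have [pj|pj] := eqVneq (p j) 0.
    by rewrite pj invr0 mulr0 mulr_ge0 ?sqr_ge0 // ltW.
  rewrite hz /D (negbTE pj) exprMn expr2.
  by rewrite mulrAC mulfK.
have c : bform H x z <= 0.
  have e : \sum_j D j * (z j - x j) ^+ 2 = bform H z z - bform H x z.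
    by rewrite qz qxz -sumrB; apply: eq_bigr => j _; ring.
  by lra.
have := bform_le_diag (fun i => 1 * z i + (-1) * x i).
rewrite bform_lincomb // (bformC z) // => h.
have {h} : bform H z z - 2 * bform H x z + bform H x x <=
    \sum_j D j * (z j - x j) ^+ 2.
  apply: le_trans (_ : _ <= \sum_i p i * (1 * z i + -1 * x i) ^+ 2) _; first lra.
  apply: ler_sum => i _; rewrite mul1r mulN1r ler_wpM2r ?sqr_ge0 //.
have -> : \sum_j D j * (z j - x j) ^+ 2 = bform H z z - bform H x z.
  by rewrite qz qxz -sumrB; apply: eq_bigr => j _; ring.
by move=> h; lra.
Qed.

(** [S x - s 1] is a multiple of the projection of [x] along the constants, so [bform_le0] applies
    to it; as [H 1 = p], its form is [S * (S * bform H x x - s ^+ 2)]. *)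
Lemma hyperbolic_bform x :
  (\sum_i p i) * bform H x x <= (\sum_i p i * x i) ^+ 2.
Proof.
set S := \sum_i p i; set s := \sum_i p i * x i.
have S_ge0 : 0 <= S by apply: sumr_ge0.
have [S0|S0] := eqVneq S 0; first by rewrite S0 mul0r sqr_ge0.
have b11 : bform H (fun=> 1) (fun=> 1) = S.
  rewrite bformE; apply: eq_bigr => i _; rewrite mul1r -H_sum.
  by apply: eq_bigr => j _; rewrite mulr1.
have bx1 : bform H x (fun=> 1) = s.
  rewrite bformE; apply: eq_bigr => i _; rewrite mulrC -H_sum; congr (_ * _).
  by apply: eq_bigr => j _; rewrite mulr1.
have := @bform_le0 (fun i => S * x i + (- s) * 1).
rewrite bform_lincomb // b11 bx1 => h.
have {h} : S * (S * bform H x x - s ^+ 2) <= 0.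
  apply: le_trans (h _); first by rewrite le_eqVlt; apply/orP; left; apply/eqP; ring.
  have -> : \sum_i p i * (S * x i + - s * 1) = S * s - s * S.
    by rewrite !mulr_sumr -sumrB; apply: eq_bigr => i _; ring.
  by rewrite mulrC subrr.
by rewrite pmulr_rle0 ?subr_le0 // lt_def S0.
Qed.

End QuadraticForms.

(** * Augmentation in a matroid and a reversed Cauchy inequality *)

Lemma basis_extension (E : finType) (M : matroid E) (A B J : {set E}) :
  A \in bases M -> B \in bases M -> J \subset B ->
  exists2 C, C \in bases M & (J \subset C) && (C \subset J :|: A).
Proof.
move=> MA; elim: {B}_.+1 {-2}B (ltnSn #|B :\: (J :|: A)|) => // n IHn B.
rewrite ltnS => leB MB JB.
have [/eqP B0|[a]] := set_0Vmem (B :\: (J :|: A)).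
  by exists B; rewrite // JB -setD_eq0.
rewrite !inE negb_or => /andP[/andP[aJ aA] aB].
(* Exchanging [a] for an element of [A] keeps [J] inside, as [a] is not in [J], and shrinks
   [B :\: (J :|: A)]. *)
have [|b] := @basis_exchange _ _ _ _ MB MA a; first by rewrite !inE aA.
rewrite !inE => /andP[bB bA] MB'.
apply: (IHn (b |: (B :\ a))) => //; last first.
  apply/subsetP => x xJ; rewrite !inE (subsetP JB) // andbT.
  by apply/orP; right; apply: contraNneq aJ => <-.
apply: leq_trans leB; apply: proper_card; apply/properP; split.
  apply/subsetP => x; rewrite !inE negb_or.
  by case: eqP => [->|_] /=; [rewrite bA andbF|case: (x == a) => /=; rewrite ?andbF].
by exists a; rewrite !inE ?negb_or ?aJ ?aA //= eqxx orbF; apply: contraNneq bB => <-.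
Qed.

(** Here [q1], [q2] and [b] stand for a form and its polarization at two vectors where a linear form
    takes the values [l1] and [l2]; the last hypothesis is nonpositivity at the combination killed
    by the linear form. With [u = l1 ^+ 2 * q2] and [v = l2 ^+ 2 * q1], the reason is
    [u * v <= ((u + v) / 2) ^+ 2]. *)
Lemma reverse_cauchy (R : realFieldType) (c q1 q2 b l1 l2 : R) :
  0 <= q1 -> q1 <= c * l1 ^+ 2 -> q2 <= c * l2 ^+ 2 ->
  l1 ^+ 2 * q2 + l2 ^+ 2 * q1 <= 2 * (l1 * l2 * b) -> q1 * q2 <= b ^+ 2.
Proof.
move=> q1_ge0 le1 le2 le12.
have [l10|l1n0] := eqVneq l1 0.
  have -> : q1 = 0 by apply/le_anti; rewrite q1_ge0 (le_trans le1) // l10 expr0n mulr0.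
  by rewrite mul0r sqr_ge0.
have [q2le0|q2gt0] := lerP q2 0.
  by apply: le_trans (sqr_ge0 b); rewrite mulr_ge0_le0.
have l2n0 : l2 != 0.
  by apply: contraTneq q2gt0 => l20; rewrite -leNgt (le_trans le2) // l20 expr0n mulr0.
have s_gt0 : 0 < (l1 * l2) ^+ 2 by rewrite exprn_even_gt0 // mulf_neq0.
rewrite -(ler_pM2l s_gt0) -exprMn.
have u_ge0 : 0 <= l1 ^+ 2 * q2 by rewrite mulr_ge0 ?sqr_ge0 // ltW.
have v_ge0 : 0 <= l2 ^+ 2 * q1 by rewrite mulr_ge0 ?sqr_ge0.
have -> : (l1 * l2) ^+ 2 * (q1 * q2) = (l1 ^+ 2 * q2) * (l2 ^+ 2 * q1) by ring.
move: (l1 ^+ 2 * q2) (l2 ^+ 2 * q1) (l1 * l2 * b) u_ge0 v_ge0 le12 => u v t.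
move=> u_ge0 v_ge0 uvt; have := sqr_ge0 (u - v).
have : 0 <= (2 * t - (u + v)) * (2 * t + (u + v)) by apply: mulr_ge0; lra.
by rewrite !expr2; lra.
Qed.

(** * Forms attached to the contractions of a matroid *)

Section Links.
Variables (R : realType) (E : finType) (M : matroid E) (w : E -> R).
Hypothesis w_gt0 : forall e, 0 < w e.
Implicit Types (I b : {set E}) (i j k : E) (y : E -> R).

Definition mass I : R := \sum_(b | (b \in bases M) && (I \subset b)) basis_weight w b.

Definition link1 I i : R := if i \in I then 0 else mass (i |: I).

(** Up to a factor and a rescaling of the coordinates by [w], this is the Hessian at [w] of the
    derivative along [I] of the basis generating polynomial. That polynomial is multiaffine, hence
    the zero rows on [I] and the zero diagonal. *)
Definition link I i j : R := if i \in I then 0 else link1 (i |: I) j.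

Lemma basis_weight_gt0 b : 0 < basis_weight w b.
Proof. exact: prodr_gt0. Qed.

Lemma mass_ge0 I : 0 <= mass I.
Proof. by apply: sumr_ge0 => b _; apply/ltW/basis_weight_gt0. Qed.

Lemma mass_gt0P I :
  reflect (exists2 b, b \in bases M & I \subset b) (0 < mass I).
Proof.
apply: (iffP idP) => [|[b Mb Ib]]; last first.
  rewrite /mass (bigD1 b) ?Mb //=; apply: ltr_wpDr (basis_weight_gt0 b).
  by apply: sumr_ge0 => c _; apply/ltW/basis_weight_gt0.
have [b /andP[Mb Ib] _|no] := pickP [pred b | (b \in bases M) && (I \subset b)].
  by exists b.
by rewrite /mass big_pred0 ?ltxx.
Qed.

Lemma mass_basis I : #|I| = rank M -> 0 < mass I -> mass I = basis_weight w I.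
Proof.
move=> cI /mass_gt0P[b Mb Ib].
have eqI c : c \in bases M -> I \subset c -> c = I.
  by move=> Mc Ic; apply/esym/eqP; rewrite eqEcard Ic cI (card_basis Mc) /=.
rewrite /mass (big_pred1 I) // => c; apply/andP/eqP => [[Mc /(eqI _ Mc)]|->] //.
by rewrite -{1}(eqI b).
Qed.

Lemma link1_ge0 I i : 0 <= link1 I i.
Proof. by rewrite /link1; case: ifP => // _; apply: mass_ge0. Qed.

Lemma link_ge0 I i j : 0 <= link I i j.
Proof. by rewrite /link; case: ifP => // _; apply: link1_ge0. Qed.

Lemma linkE I i j : link I i j =
  if [|| i \in I, j \in I | i == j] then 0 else mass (i |: (j |: I)).
Proof.
rewrite /link /link1 !inE; case: (i \in I) => //=.
by rewrite eq_sym setUCA orbC.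
Qed.

Lemma link_sym I i j : link I i j = link I j i.
Proof. by rewrite !linkE eq_sym setUCA orbCA. Qed.

(** Euler's identity by double counting: each basis containing [I] has [rank M - #|I|] elements
    outside [I]. *)
Lemma sum_link1 I : \sum_i link1 I i = (rank M - #|I|)%:R * mass I.
Proof.
have -> : \sum_i link1 I i = \sum_(i | i \notin I) mass (i |: I).
  by rewrite [RHS]big_mkcond; apply: eq_bigr => i _; rewrite /link1; case: (i \in I).
rewrite /mass (exchange_big_dep (fun b => (b \in bases M) && (I \subset b))) /=; last first.
  by move=> i b _; rewrite subUset => /and3P[-> _ ->].
rewrite mulr_sumr; apply: eq_bigr => b /andP[Mb Ib].
rewrite sumr_const mulr_natl -(card_basis Mb); congr (_ *+ _).
rewrite -[in RHS](setIidPr Ib) -cardsD; apply: eq_card => i.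
by rewrite unfold_in /= Mb subUset sub1set Ib andbT !inE.
Qed.

Lemma sum_link I i : \sum_j link I i j = (rank M - #|I| - 1)%:R * link1 I i.
Proof.
rewrite /link /link1; case: ifP => iI; first by rewrite mulr0 big1.
by rewrite sum_link1 cardsU1 iI add1n subnS subn1.
Qed.

(** Euler's identity for second derivatives; it drives the induction on the corank. *)
Lemma sum_link_setU1 I i j :
  \sum_(k | k \notin I) link (k |: I) i j = (rank M - #|I| - 2)%:R * link I i j.
Proof.
have [iI|iI] := boolP (i \in I).
  rewrite {2}/link iI mulr0 big1 // => k kI.
  by rewrite /link !inE iI orbT.
have [jI|jI] := boolP (j \in i |: I).
  rewrite {2}/link (negbTE iI) /link1 jI mulr0 big1 // => k kI.
  rewrite linkE; move: jI; rewrite !inE => /orP[/eqP ->|->].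
    by rewrite eqxx !orbT.
  by rewrite !orbT.
have -> : link I i j = mass (j |: (i |: I)).
  by rewrite /link (negbTE iI) /link1 (negbTE jI).
have -> : (rank M - #|I| - 2 = rank M - #|j |: (i |: I)|)%N.
  by rewrite !cardsU1 iI jI addnA [in RHS]addnC subnDA.
rewrite -sum_link1 [LHS]big_mkcond; apply: eq_bigr => k _.
move: jI; rewrite /link1 linkE !inE negb_or => /andP[ji jI].
rewrite (negbTE iI) (negbTE jI) !orbF (eq_sym i k) (eq_sym j k) (eq_sym i j).
rewrite (negbTE ji) orbF.
case: (k \in I) => /=; first by rewrite !orbT.
rewrite orbF orbC; case: ifP => // _; congr mass.
by apply/setP => x; rewrite !inE; do !bool_congr.
Qed.

(* The augmentation axiom for the rank-two contractions, i.e. transitivity of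
   parallelism. *)
Lemma link_triangle I i j k : 0 < link I i k -> 0 < link1 I j ->
  0 < link I i j \/ 0 < link I j k.
Proof.
rewrite !linkE /link1; case: ifP; rewrite ?ltxx // => /norP[iI /norP[kI ik]].
case: ifP => jI; rewrite ?ltxx // => /mass_gt0P[A MA ikA] /mass_gt0P[B MB jB].
rewrite (negbTE iI) (negbTE kI) /=.
have [C MC /andP[jC CA]] := basis_extension MA MB jB.
have jCI : (j \in C) && (I \subset C) by move: jC; rewrite subUset sub1set.
have [<-|nij] := eqVneq i j.
  by right; rewrite (negbTE ik); apply/mass_gt0P; exists A.
have [->|njk] := eqVneq j k; first by left; apply/mass_gt0P; exists A.
have [iC|iC] := boolP (i \in C).
  by left; apply/mass_gt0P; exists C; rewrite // subUset sub1set iC.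
have [kC|kC] := boolP (k \in C).
  right; apply/mass_gt0P; exists C => //.
  by rewrite setUCA subUset sub1set kC.
(* A basis [C] avoiding both [i] and [k] would have at most [#|A| - 1] elements. *)
have sub : C \subset j |: (A :\ i :\ k).
  apply/subsetP => x xC; have := subsetP CA x xC; rewrite !inE.
  have -> : x != k by apply: contraNneq kC => <-.
  have -> : x != i by apply: contraNneq iC => <-.
  case: (x == j) => //= /orP[xI|//].
  by apply: (subsetP ikA); rewrite !inE xI !orbT.
have iA : i \in A by apply: (subsetP ikA); rewrite !inE eqxx.
have kA : k \in A :\ i.
  by rewrite !inE eq_sym ik; apply: (subsetP ikA); rewrite !inE eqxx orbT.
have := subset_leq_card sub.
rewrite cardsU1 (card_basis MC) -(card_basis MA) (cardsD1 i A) iA.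
rewrite (cardsD1 k (A :\ i)) kA => /leq_trans/(_ (leq_add (leq_b1 _) (leqnn _))).
by rewrite !add1n ltnn.
Qed.

(** A positive row sum provides a neighbour [k] of [i], and [link_triangle] joins [j] to [i] or to
    [k]. *)
Lemma link_connected I y : (2 <= rank M - #|I|)%N ->
  (forall i j, 0 < link I i j -> y i = y j) ->
  forall i j, 0 < link1 I i -> 0 < link1 I j -> y i = y j.
Proof.
move=> r2 yE i j Ii Ij.
have : 0 < \sum_k link I i k.
  by rewrite sum_link mulr_gt0 // ltr0n subn_gt0.
have [k ik _|no] := pickP (fun k => 0 < link I i k); last first.
  by rewrite big1 ?ltxx // => k _; apply/le_anti; rewrite link_ge0 leNgt no.
have [ij|jk] := link_triangle ik Ij; first exact: yE.
by rewrite (yE _ _ ik) (yE _ _ jk).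
Qed.

(** * Signature of the forms: corank two, then induction *)

Lemma link_rank2 I i j : (rank M - #|I| = 2)%N ->
  link I i j = (0 < link I i j)%R%:R * (basis_weight w I * w i * w j).
Proof.
move=> r2; have [ij0|] := boolP (0 < link I i j); last first.
  by rewrite mul0r -leNgt => ?; apply/le_anti; rewrite link_ge0 andbT.
move: ij0; rewrite linkE; case: ifP; rewrite ?ltxx // => /norP[iI /norP[jI ij]].
have iJ : i \notin j |: I by rewrite !inE negb_or ij.
move=> /mass_basis ->; last first.
  have leI : (#|I| <= rank M)%N by rewrite ltnW // -subn_gt0 r2.
  by rewrite !cardsU1 iJ jI -[in RHS](subnKC leI) r2 addn2.
by rewrite /basis_weight !big_setU1 //=; ring.
Qed.

(** Grouping by classes gives a sum of squares of class sums; subsets [C] that are not classes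
    contribute zero. *)
Lemma per_form_ge0 (N : pred E) (e : rel E) y :
  (forall i, N i -> e i i) -> symmetric e -> transitive e ->
  0 <= \sum_(i | N i) \sum_(j | N j) (e i j)%:R * y i * y j.
Proof.
move=> e_refl e_sym e_trans.
pose cl i := [set k | e i k].
have clE i j : N i -> N j -> (e i j)%:R = (cl i == cl j)%:R :> R.
  move=> Ni Nj; congr (nat_of_bool _)%:R; apply/idP/eqP => [eij|].
    apply/setP => k; rewrite !inE; apply/idP/idP; last exact: e_trans.
    by apply: e_trans; rewrite e_sym.
  by move/setP/(_ j); rewrite !inE e_refl.
suff -> : \sum_(i | N i) \sum_(j | N j) (e i j)%:R * y i * y j =
    \sum_(C : {set E}) (\sum_(i | N i) (cl i == C)%:R * y i) ^+ 2.
  by apply: sumr_ge0 => C _; apply: sqr_ge0.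
transitivity (\sum_(i | N i) \sum_(j | N j) \sum_(C : {set E})
    ((cl i == C)%:R * y i) * ((cl j == C)%:R * y j)).
  apply: eq_bigr => i Ni; apply: eq_bigr => j Nj.
  rewrite (bigD1 (cl j)) //= eqxx big1 ?addr0 => [|C /negbTE nC].
    by rewrite clE // !mulrA mulr1.
  by rewrite [cl j == C]eq_sym nC mul0r mulr0.
under eq_bigr do rewrite exchange_big.
rewrite exchange_big /=; apply: eq_bigr => C _.
by rewrite expr2 mulr_suml; apply: eq_bigr => i _; rewrite mulr_sumr.
Qed.

Definition link_hyperbolic I := forall y,
  (rank M - #|I|)%:R * mass I * bform (link I) y y <=
  (rank M - #|I| - 1)%:R * (\sum_i link1 I i * y i) ^+ 2.

Lemma link_hyperbolic_rank2 I : (rank M - #|I| = 2)%N -> link_hyperbolic I.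
Proof.
move=> r2 y.
set c := basis_weight w I; have c_gt0 : 0 < c by apply: basis_weight_gt0.
pose N i := 0 < link1 I i.
(* [e] is parallelism among the non-loops of the contraction; its transitivity is
   [link_triangle]. *)
pose e i j := [&& N i, N j & ~~ (0 < link I i j)].
pose L z := \sum_(i | N i) w i * z i.
have HN i j : link I i j = if N i && N j then link I i j else 0.
  have l0 k l : ~~ N k -> link I k l = 0.
    move=> /negP Nk; apply/le_anti; rewrite link_ge0 andbT leNgt.
    apply/negP => kl; apply: Nk; rewrite /N.
    have : 0 < \sum_j link I k j.
      rewrite (bigD1 l) //=; apply: ltr_wpDr kl.
      by apply: sumr_ge0 => ? _; apply: link_ge0.
    by rewrite sum_link r2 mul1r.
  have [Ni|/l0 ->] := boolP (N i); last by [].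
  have [//|/l0 h] := boolP (N j).
  by rewrite link_sym h.
have le_L z : bform (link I) z z <= c * L z ^+ 2.
  have := @per_form_ge0 N e (fun i => w i * z i).
  set S := \sum_(i | _) _ => S_ge0.
  have {}S_ge0 : 0 <= S.
    apply: S_ge0 => [i Ni|i j|j i k].
    - by rewrite /e Ni linkE eqxx !orbT ltxx.
    - by rewrite /e link_sym andbCA.
    rewrite /e => /and3P[-> Nj nij] /and3P[_ -> njk] /=.
    by apply/negP => /link_triangle/(_ Nj)[]; apply/negP.
  suff -> : bform (link I) z z = c * (L z ^+ 2 - S).
    by rewrite ler_pM2l // gerBl.
  rewrite /L expr2 mulr_suml -sumrB mulr_sumr /bform [RHS]big_mkcond /=.
  apply: eq_bigr => i _; case: ifP => Ni; last first.
    by apply: big1 => j _; rewrite HN Ni !mul0r.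
  rewrite mulr_sumr -sumrB mulr_sumr [RHS]big_mkcond /=.
  apply: eq_bigr => j _; rewrite HN Ni /=; case: ifP => Nj; last by rewrite !mul0r.
  rewrite link_rank2 // /e Ni Nj -/c; case: (0 < _); rewrite /=; ring.
have sum1 i : \sum_j link I i j = link1 I i by rewrite sum_link r2 mul1r.
have b11 : bform (link I) (fun=> 1) (fun=> 1) = (rank M - #|I|)%:R * mass I.
  rewrite -sum_link1 bformE; apply: eq_bigr => i _; rewrite mul1r -sum1.
  by apply: eq_bigr => j _; rewrite mulr1.
have by1 : bform (link I) y (fun=> 1) = \sum_i link1 I i * y i.
  rewrite bformE; apply: eq_bigr => i _; rewrite mulrC -sum1; congr (_ * _).
  by apply: eq_bigr => j _; rewrite mulr1.
rewrite -b11 -by1 r2 mul1r.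
have q1_ge0 : 0 <= bform (link I) (fun=> 1) (fun=> 1).
  by rewrite b11 mulr_ge0 ?mass_ge0.
(* This combination of [y] and the constant vector lies in the kernel of [L], so its form is
   nonpositive. *)
have := le_L (fun i => L (fun=> 1) * y i + (- L y) * 1).
rewrite (bform_lincomb _ _ _ _ (@link_sym I)).
have -> : L (fun i => L (fun=> 1) * y i + (- L y) * 1) =
    L (fun=> 1) * L y - L y * L (fun=> 1).
  by rewrite {1 5}/L !mulr_sumr -sumrB; apply: eq_bigr => i _; ring.
rewrite [L y * _]mulrC subrr expr0n mulr0 => le12.
by apply: reverse_cauchy q1_ge0 (le_L _) (le_L y) _; lra.
Qed.

Lemma link_hyperbolicP I : (2 <= rank M - #|I|)%N -> link_hyperbolic I.
Proof.
move=> r2; have [n rE] : exists n, (rank M - #|I| = n.+2)%N.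
  by exists (rank M - #|I|).-2; rewrite -[LHS](subnKC r2) subn2.
elim: n I rE {r2} => [|n IHn] I rE; first exact: link_hyperbolic_rank2.
move=> y; pose p i := n.+2%:R * link1 I i.
have sum_p i : \sum_j link I i j = p i by rewrite sum_link rE subn1.
have rSE k : k \notin I -> (rank M - #|k |: I| = n.+2)%N.
  by move=> kI; rewrite cardsU1 kI add1n subnS rE.
(* Summing the induction hypotheses for [k |: I] over [k]: the linear form there is row [k] of
   [link I] applied to [x], and its normalization [n.+2%:R * mass (k |: I)] is the row sum [p k]. *)
have garding x : bform (link I) x x <= \sum_i (\sum_j link I i j * x j) ^+ 2 / p i.
  rewrite -(@ler_pM2l _ n.+1%:R) ?ltr0n //.
  have -> : n.+1%:R * bform (link I) x x =
      \sum_(k | k \notin I) bform (link (k |: I)) x x.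
    rewrite /bform [RHS]exchange_big mulr_sumr; apply: eq_bigr => i _ /=.
    rewrite [RHS]exchange_big mulr_sumr; apply: eq_bigr => j _ /=.
    rewrite -!mulr_suml sum_link_setU1 rE subn2 /=; ring.
  rewrite mulr_sumr [leLHS]big_mkcond /=; apply: ler_sum => k _.
  have sqp_ge0 : 0 <= n.+1%:R * ((\sum_j link I k j * x j) ^+ 2 / p k).
    by rewrite mulr_ge0 ?divr_ge0 ?sqr_ge0 ?mulr_ge0 ?link1_ge0.
  case: ifP => // kI; have := IHn _ (rSE _ kI) x.
  rewrite rSE // subn1 /= => h.
  have pE : p k = n.+2%:R * mass (k |: I) by rewrite /p /link1 (negbTE kI).
  have lE : \sum_j link I k j * x j = \sum_j link1 (k |: I) j * x j.
    by apply: eq_bigr => j _; rewrite /link (negbTE kI).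
  (* If no basis contains [k |: I], the form of that contraction is zero. *)
  have [m0|m0] := eqVneq (mass (k |: I)) 0.
    suff -> : bform (link (k |: I)) x x = 0 by [].
    rewrite /bform big1 // => i _; rewrite big1 // => j _.
    suff -> : link (k |: I) i j = 0 by rewrite !mul0r.
    apply/le_anti; rewrite link_ge0 andbT linkE; case: ifP => // _.
    rewrite leNgt; apply/negP => /mass_gt0P[b Mb ib].
    have : 0 < mass (k |: I).
      apply/mass_gt0P; exists b => //; apply: subset_trans ib.
      by rewrite setUA subsetUr.
    by rewrite m0 ltxx.
  have p_gt0 : 0 < p k by rewrite pE mulr_gt0 ?ltr0n // lt_def m0 mass_ge0.
  by rewrite lE mulrA ler_pdivlMr // mulrC pE.
have conn (x : E -> R) : (forall i j, 0 < link I i j -> x i = x j) ->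
    forall i j, 0 < p i -> 0 < p j -> x i = x j.
  move=> xE i j; rewrite /p !pmulr_rgt0 ?ltr0n // => Ii Ij.
  by apply: (link_connected _ xE Ii Ij); rewrite rE.
have := hyperbolic_bform (@link_sym I) (@link_ge0 I) sum_p conn garding y.
rewrite -mulr_sumr sum_link1 rE subn1 /=.
have -> : \sum_i p i * y i = n.+2%:R * \sum_i link1 I i * y i.
  by rewrite mulr_sumr; apply: eq_bigr => i _; rewrite mulrA.
have n_gt0 : 0 < n.+2%:R :> R by rewrite ltr0n.
by rewrite exprMn expr2 -!mulrA ler_pM2l // !mulrA.
Qed.

(** * Correlation of two elements without conditioning *)

Lemma pair_correlation i j : i != j ->
  (rank M)%:R * mass set0 * mass [set i; j] <=
  2 * (rank M - 1)%:R * mass [set i] * mass [set j].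
Proof.
move=> ij; have mS (I J : {set E}) : I \subset J -> mass I = 0 -> mass J = 0.
  move=> IJ mI; apply/le_anti; rewrite mass_ge0 andbT leNgt; apply/negP.
  move=> /mass_gt0P[b Mb Jb]; suff : 0 < mass I by rewrite mI ltxx.
  by apply/mass_gt0P; exists b => //; apply: subset_trans Jb.
have rhs_ge0 : 0 <= 2 * (rank M - 1)%:R * mass [set i] * mass [set j].
  by rewrite !mulr_ge0 ?mass_ge0.
have [mij|mij] := eqVneq (mass [set i; j]) 0; first by rewrite mij mulr0.
have mi : 0 < mass [set i].
  rewrite lt_def mass_ge0 andbT; apply: contra_neq mij; apply: mS.
  by rewrite sub1set !inE eqxx.
have mj : 0 < mass [set j].
  rewrite lt_def mass_ge0 andbT; apply: contra_neq mij; apply: mS.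
  by rewrite sub1set !inE eqxx orbT.
have r2 : (2 <= rank M - #|(set0 : {set E})|)%N.
  have /mass_gt0P[b Mb ijb] : 0 < mass [set i; j] by rewrite lt_def mij mass_ge0.
  rewrite cards0 subn0 -(card_basis Mb).
  by apply: leq_trans (subset_leq_card ijb); rewrite cards2 ij.
(* These coefficients give [i] and [j] equal shares in the linear form, which is the optimal choice
   for a vector supported on [i] and [j]. *)
pose y k := mass [set j] * (k == i)%:R + mass [set i] * (k == j)%:R.
have sum1 (F : E -> R) k : \sum_l F l * (l == k)%:R = F k.
  rewrite (bigD1 k) //= eqxx mulr1 big1 ?addr0 // => l /negbTE ->.
  by rewrite mulr0.
have l1E k : link1 set0 k = mass [set k] by rewrite /link1 inE setU0.
have b2 k l : bform (link set0) (fun x => (x == k)%:R) (fun x => (x == l)%:R)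
    = link set0 k l.
  rewrite bformE -[RHS](sum1 (fun k => link set0 k l)); apply: eq_bigr => x _.
  by rewrite sum1 mulrC.
have := link_hyperbolicP r2 y.
rewrite (bform_lincomb _ _ _ _ (@link_sym _)) !b2 cards0 subn0.
have -> : \sum_k link1 set0 k * y k = 2 * (mass [set i] * mass [set j]).
  under eq_bigr do rewrite mulrDr [mass [set j] * _]mulrC [mass [set i] * _]mulrC !mulrA.
  by rewrite big_split /= -!mulr_suml !sum1 !l1E; ring.
rewrite !linkE !inE !eqxx (negbTE ij) /= !setU0 => h.
have s_gt0 : 0 < 2 * (mass [set i] * mass [set j]) by rewrite !mulr_gt0.
rewrite -(ler_pM2l s_gt0); move: h; rewrite [i |: _]setUC ?[[set j] :|: _]setUC; lra.
Qed.

End Links.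

(** * Letting the weights of [i] and [j] tend to zero *)

Lemma le_limit_at0 (R : realFieldType) (d e a b c f : R) :
  0 <= d -> 0 <= e -> 0 <= a -> 0 <= b -> 0 <= c ->
  (forall t, 0 < t ->
    d * (t ^+ 2 * a + t * b + t * c + f) * (t ^+ 2 * a) <=
    e * (t ^+ 2 * a + t * b) * (t ^+ 2 * a + t * c)) ->
  d * (a * f) <= e * (b * c).
Proof.
move=> d0 e0 a0 b0 c0 le_t; rewrite leNgt; apply/negP => gt_0.
pose X := d * (a * f) - e * (b * c); have X_gt0 : 0 < X by rewrite /X; lra.
pose N := e * (a ^+ 2 + a * (b + c)).
have N_ge0 : 0 <= N by rewrite mulr_ge0 ?addr_ge0 ?mulr_ge0 ?sqr_ge0 ?addr_ge0.
(* Dividing the hypothesis by [t ^+ 2] and using [t <= 1] gives [X <= t * N], whereas this [t] makes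
   [t * N] at most [X / 2]. *)
pose t := X / (2 * (N + X)).
have NX_gt0 : 0 < 2 * (N + X) by lra.
have t_gt0 : 0 < t by rewrite divr_gt0.
have t_le1 : t <= 1 by rewrite ler_pdivrMr //; lra.
have t2_gt0 : 0 < t ^+ 2 by rewrite exprn_gt0.
have le1 : d * (t ^+ 2 * a + t * b + t * c + f) * a <= e * (t * a + b) * (t * a + c).
  by rewrite -(ler_pM2l t2_gt0); move: (le_t t t_gt0); rewrite !expr2; lra.
have le2 : 0 <= d * (t ^+ 2 * a + t * b + t * c) * a.
  have t_ge0 := ltW t_gt0; have t2_ge0 := ltW t2_gt0.
  by rewrite mulr_ge0 // mulr_ge0 // !addr_ge0 // mulr_ge0.
have le3 : 0 <= (t - t ^+ 2) * (e * a ^+ 2).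
  by rewrite mulr_ge0 ?mulr_ge0 ?sqr_ge0 // subr_ge0 expr2 ler_piMr // ltW.
have le4 : X <= t * N.
  have -> : t * N = t * e * a ^+ 2 + t * e * a * b + t * e * a * c by rewrite /N; ring.
  by rewrite /X; move: le1 le2 le3; rewrite !expr2; lra.
have : X * (2 * (N + X)) <= X * N.
  apply: le_trans (_ : t * N * (2 * (N + X)) <= _); first by rewrite ler_pM2r.
  by rewrite mulrAC /t mulfVK // gt_eqF.
by rewrite ler_pM2l //; lra.
Qed.

(** * Passage to probabilities *)

Section Correlation.
Variables (R : realType) (E : finType) (M : matroid E) (w : E -> R).
Hypothesis w_gt0 : forall e, 0 < w e.
Variables (i j : E).
Hypothesis ij : i != j.
Implicit Types (P : pred {set E}) (b : {set E}) (t : R).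

Definition weight_of P : R := \sum_(b in bases M) (P b)%:R * basis_weight w b.

Lemma PrE P : Pr M w P = weight_of P / total_weight M w.
Proof.
rewrite /Pr /weight_of mulr_suml [LHS]big_mkcond [RHS]big_mkcond /=.
apply: eq_bigr => b _; rewrite /basis_law.
by case: (P b); case: ifP; rewrite ?mul1r ?mul0r.
Qed.

Lemma weight_of_ge0 P : 0 <= weight_of P.
Proof. by apply: sumr_ge0 => b _; rewrite mulr_ge0 // prodr_ge0 // => e _; rewrite ltW. Qed.

Definition scale t e : R := if (e == i) || (e == j) then t * w e else w e.

Lemma scale_gt0 t e : 0 < t -> 0 < scale t e.
Proof. by move=> t_gt0; rewrite /scale; case: ifP => _ //; apply: mulr_gt0. Qed.

Lemma basis_weight_scale t b :
  basis_weight (scale t) b = t ^+ (i \in b) * t ^+ (j \in b) * basis_weight w b.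
Proof.
have prod1 k : \prod_(e in b) (if e == k then t else 1) = t ^+ (k \in b).
  rewrite -big_mkcondr /=; have [kb|kb] := boolP (k \in b).
    rewrite (big_pred1 k) ?expr1 // => e /=.
    by case: eqP => [->|]; rewrite ?kb ?andbF.
  rewrite big_pred0 ?expr0 // => e.
  by case: eqP => [->|]; rewrite ?(negbTE kb) ?andbF.
rewrite -!prod1 -!big_split /=; apply: eq_bigr => e _.
rewrite /scale; have [->|_] := eqVneq e i; first by rewrite (negbTE ij) /= mulr1.
by case: (e == j) => /=; ring.
Qed.

Let a := weight_of [pred b : {set E} | (i \in b) && (j \in b)].
Let b := weight_of [pred b : {set E} | (i \in b) && (j \notin b)].
Let c := weight_of [pred b : {set E} | (i \notin b) && (j \in b)].
Let f := weight_of [pred b : {set E} | (i \notin b) && (j \notin b)].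

(** Bases are sorted by whether they contain [i] and [j]; each Boolean tells whether the bases of
    one class contain [I]. *)
Lemma mass_scale t (I : {set E}) (s1 s2 s3 s4 : bool) :
  (forall b : {set E}, (I \subset b) =
     if i \in b then if j \in b then s1 else s2
     else if j \in b then s3 else s4) ->
  mass M (scale t) I =
  s1%:R * t ^+ 2 * a + s2%:R * t * b + s3%:R * t * c + s4%:R * f.
Proof.
move=> IE; rewrite /mass big_mkcondr /= /a /b /c /f /weight_of.
rewrite !mulr_sumr -!big_split /=; apply: eq_bigr => B _.
rewrite IE basis_weight_scale.
by case: (i \in B); case: (j \in B) => /=; case: ifP => _;
   rewrite /= ?expr0 ?expr1; ring.
Qed.

Lemma weight_correlation :
  (rank M)%:R * (a * f) <= 2 * (rank M - 1)%:R * (b * c).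
Proof.
apply: le_limit_at0; rewrite ?mulr_ge0 ?weight_of_ge0 // => t t_gt0.
have := pair_correlation M (fun e => scale_gt0 e t_gt0) ij.
rewrite (@mass_scale t set0 true true true true); last first.
  by move=> B; rewrite sub0set; do 2 case: ifP.
rewrite (@mass_scale t [set i; j] true false false false); last first.
  by move=> B; rewrite subUset !sub1set; do 2 case: ifP.
rewrite (@mass_scale t [set i] true true false false); last first.
  by move=> B; rewrite sub1set; do 2 case: ifP.
rewrite (@mass_scale t [set j] true false true false); last first.
  by move=> B; rewrite sub1set; do 2 case: ifP.
by rewrite /= !(mul1r, mul0r, addr0).
Qed.

End Correlation.

Theorem theorem1p5 (R : realType) (E : finType) (M : matroid E) (d : nat)
    (hM : rank M = d) (hd : (0 < d)%N)
    (w : E -> R) (hw : forall e : E, 0 < w e)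
    (i j : E) (hij : i <> j) :
  Pr M w [pred b : {set E} | (i \in b) && (j \in b)]
    * Pr M w [pred b : {set E} | (i \notin b) && (j \notin b)]
  <= 2 * (1 - 1 / d%:R)
    * (Pr M w [pred b : {set E} | (i \in b) && (j \notin b)]
       * Pr M w [pred b : {set E} | (i \notin b) && (j \in b)]).
Proof.
have ij : i != j by apply/eqP.
have := weight_correlation M hw ij; rewrite !PrE hM natrB // => le_d.
have d_gt0 : 0 < d%:R :> R by rewrite ltr0n.
have d_neq0 : d%:R != 0 :> R by rewrite gt_eqF.
have Z_gt0 := total_weight_gt0 M hw.
(* Both sides carry the same denominator [Z * Z], so only the factor [d] has to be cleared. *)
rewrite -(ler_pM2l d_gt0) !mulf_div.
set Z := total_weight M w in Z_gt0 *.
have -> (x : R) : d%:R * (2 * (1 - 1 / d%:R) * x) = 2 * (d%:R - 1) * x by field.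
by rewrite !mulrA in le_d *; rewrite ler_pM2r ?invr_gt0 ?mulr_gt0.
Qed.
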